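(* Let $k\ge1$, let $\overline n=(n_1,\ldots,n_k)$ be non-negative integers with $n_1\ge n_2\ge\cdots\ge n_k$, and let $\overline H=(H_1,\ldots,H_k)$, where $H_i=(d_{i,0},d_{i,1},\ldots)$ is a sequence of non-negative integers with $\sum_{j\ge0}d_{i,j}=n_i$. Let $E(\overline H)=\{i\in\mathbb Z_{\ge0}\mid d_{1,i}=d_{2,i}=\cdots=d_{k,i}\}$, let $n=\sum_{i=1}^kn_i$, and let $H=(d_0,d_1,\ldots)$ be the sequence given by $d_{i+kj}=d_{i+1,j}$ for $0\le i<k$, $j\ge0$. Suppose that for any two numbers $i,j\in\mathbb Z_{\ge0}\setminus E(\overline H)$ with $i<j$ we have $j-i\ge2$. Then the variety $(\mathbb C^2)^{[\overline n]}_{1,1}(\overline H)$ is isomorphic to $(\mathbb C^2)^{[n]}_{1,k}(H)$.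
   Context: $(\mathbb C^2)^{[n]}$ is the Hilbert scheme of $n$ points on the plane, parametrizing ideals $I\subset\mathbb C[x,y]$ with $\dim_{\mathbb C}\mathbb C[x,y]/I=n$. The nested Hilbert scheme $(\mathbb C^2)^{[\overline n]}$ parametrizes $k$-tuples $(I_1,\ldots,I_k)$ of ideals of $\mathbb C[x,y]$ such that $I_j\subset I_h$ for $j<h$ and $\dim_{\mathbb C}\mathbb C[x,y]/I_j=n_j$. The torus $T=(\mathbb C^* )^2$ acts on $\mathbb C^2$ by $(t_1,t_2)(x,y)=(t_1x,t_2y)$, hence on these Hilbert schemes. For $a,b\ge1$ coprime, $T_{a,b}=\{(t^a,t^b)\mid t\in\mathbb C^*\}$, and $(\mathbb C^2)^{[n]}_{a,b}$ is the fixed point set of $T_{a,b}$ on $(\mathbb C^2)^{[n]}$; it parametrizes ideals of colength $n$ that are quasi-homogeneous for the grading in which $x^iy^j$ has degree $ai+bj$. Writing $\mathbb C[x,y]^d_{a,b}$ for the space of quasi-homogeneous polynomials of degree $d$, for $H=(d_0,d_1,\ldots)$ with $\sum d_i=n$ the subvariety $(\mathbb C^2)^{[n]}_{a,b}(H)\subset(\mathbb C^2)^{[n]}_{a,b}$ consists of the quasi-homogeneous ideals $I$ with $\dim\bigl(\mathbb C[x,y]^i_{a,b}/(I\cap\mathbb C[x,y]^i_{a,b})\bigr)=d_i$ for all $i$. Finally, $$(\mathbb C^2)^{[\overline n]}_{a,b}(\overline H)=\{(Z_1,\ldots,Z_k)\in(\mathbb C^2)^{[\overline n]}\mid Z_i\in(\mathbb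 C^2)^{[n_i]}_{a,b}(H_i),\ 1\le i\le k\}.$$ *)

(* Defs.v *)
From mathcomp Require Import all_boot all_order all_algebra.
From mathcomp Require Import boolp classical_sets reals.
From mathcomp Require Import mpoly complex.

Set Implicit Arguments.
Unset Strict Implicit.
Unset Printing Implicit Defensive.

Import GRing.Theory.
Local Open Scope ring_scope.
Local Open Scope classical_set_scope.

(* A variety is presented by its set of closed points and a family of affine
   charts; the chart [c] has domain [cdom c], and its coordinate ring consists
   of the polynomials in the functions [coord v], [v : cvar c].  There may be
   infinitely many coordinates, only finitely many of which occur in a given
   polynomial.  The values of [coord v] outside of [cdom c] are irrelevant. *)
Record charted (F : fieldType) := Charted {
  pt :> Type;
  chart : Type;
  cdom : chart -> set pt;
  cvar : chart -> Type;
  coord : forall c : chart, cvar c -> pt -> F }.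

Section Varieties.
Variable F : fieldType.

Definition polynomial_on (X : charted F) (c : chart X) (f : X -> F) : Prop :=
  exists (m : nat) (v : 'I_m -> cvar c) (P : {mpoly F[m]}),
    forall x, f x = P.@[fun i => coord (v i) x].

Definition zariski_open (X : charted F) (U : set X) : Prop :=
  forall x, U x -> exists (c : chart X) (q : X -> F),
    [/\ polynomial_on c q, cdom c x, q x != 0
      & forall y, cdom c y -> q y != 0 -> U y].

(* The structure sheaf: [f] is regular on [U] if near each point of [U] it is
   a quotient of polynomials in the coordinates of some chart. *)
Definition regular_on (X : charted F) (U : set X) (f : X -> F) : Prop :=
  forall x, U x -> exists (c : chart X) (p q : X -> F),
    [/\ polynomial_on c p, polynomial_on c q, cdom c x, q x != 0
      & forall y, U y -> cdom c y -> q y != 0 -> f y = p y / q y].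

Definition morphism (X Y : charted F) (phi : X -> Y) : Prop :=
  forall V : set Y, zariski_open V ->
    zariski_open (phi @^-1` V) /\
    forall f : Y -> F, regular_on V f -> regular_on (phi @^-1` V) (f \o phi).

Definition isomorphic (X Y : charted F) : Prop :=
  exists (phi : X -> Y) (psi : Y -> X),
    [/\ morphism phi, morphism psi, cancel phi psi & cancel psi phi].

(* Reduced structure induced on a (locally closed) set of points. *)
Definition subvariety (X : charted F) (S : set X) : charted F :=
  @Charted F {x : X | S x} (chart X) (fun c x => cdom c (sval x))
    (@cvar F X) (fun c v x => coord v (sval x)).

Definition product_variety (k : nat) (X : 'I_k -> charted F) : charted F :=
  @Charted F (forall i, X i) (forall i, chart (X i))
    (fun c x => forall i, cdom (c i) (x i))
    (fun c => {i : 'I_k & cvar (c i)})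
    (fun c v x => coord (tagged v) (x (tag v))).

End Varieties.

Section Quotients.
Variables (F : fieldType) (L : lmodType F).

Definition quot_basis (V W : set L) (n : nat) (e : 'I_n -> L) : Prop :=
  (forall i, V (e i)) /\
  forall v, V v -> exists! c : 'rV[F]_n, W (v - \sum_(i < n) c 0 i *: e i).

(* dim V / W = n, for linear subspaces W of V *)
Definition quot_dim (V W : set L) (n : nat) : Prop :=
  exists e : 'I_n -> L, quot_basis V W e.

End Quotients.

Section Hilbert.
Variable F : fieldType.

Definition varx : {mpoly F[2]} := 'X_ord0.
Definition vary : {mpoly F[2]} := 'X_ord_max.

Record ideal := Ideal {
  ideal_set :> set {mpoly F[2]};
  ideal_zero : ideal_set 0;
  ideal_add : forall f g, ideal_set f -> ideal_set g -> ideal_set (f + g);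
  ideal_mul : forall f g, ideal_set g -> ideal_set (f * g) }.

Definition hilb_pt (n : nat) := {I : ideal | quot_dim setT I n}.

Definition hilb_ideal n (Z : hilb_pt n) : ideal := sval Z.
Local Coercion hilb_ideal : hilb_pt >-> ideal.

(* The standard affine charts of the Hilbert scheme: for monomials
   B 0, ..., B (n - 1), the open set of the ideals I modulo which they form a
   basis.  Its coordinate ring is generated by the coefficients c_j(m) in
   m = c_0(m) B 0 + ... + c_(n-1)(m) B (n - 1) modulo I, for all monomials m. *)
Definition hilb_chart n (B : 'I_n -> 'X_{1..2}) : set (hilb_pt n) :=
  [set I | quot_basis setT I (fun j => 'X_[B j])].

Definition hilb_coord n (B : 'I_n -> 'X_{1..2}) (v : 'X_{1..2} * 'I_n)
    (I : hilb_pt n) : F :=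
  (xget 0 [set c : 'rV[F]_n |
     ideal_set I ('X_[v.1] - \sum_(j < n) c 0 j *: 'X_[B j])]) 0 v.2.

Definition hilb (n : nat) : charted F :=
  @Charted F (hilb_pt n) ('I_n -> 'X_{1..2}) (@hilb_chart n)
    (fun _ => ('X_{1..2} * 'I_n)%type) (@hilb_coord n).

Definition wdeg (a b : nat) (m : 'X_{1..2}) : nat :=
  (a * m ord0 + b * m ord_max)%N.

Definition qhom (a b d : nat) : set {mpoly F[2]} :=
  [set f | forall m, m \in msupp f -> wdeg a b m = d].

Definition qhom_part (a b d : nat) (f : {mpoly F[2]}) : {mpoly F[2]} :=
  \sum_(m <- msupp f | wdeg a b m == d) f@_m *: 'X_[m].

Definition qhom_ideal (a b : nat) (I : ideal) : Prop :=
  forall f, ideal_set I f -> forall d, ideal_set I (qhom_part a b d f).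

(* If I is the ideal of Z, this is the ideal of (t1, t2) Z. *)
Definition torus_act (t1 t2 : F) (I : ideal) : set {mpoly F[2]} :=
  [set f | ideal_set I (f \mPo [tuple t1 *: varx; t2 *: vary])].

Definition torus_fixed (a b : nat) (I : ideal) : Prop :=
  forall t : F, t != 0 -> torus_act (t ^+ a) (t ^+ b) I = I.

(* Over an infinite field, the first two conditions are equivalent. *)
Definition qhilb_set (a b n : nat) (H : nat -> nat) : set (hilb n) :=
  [set I : hilb_pt n |
    [/\ torus_fixed a b I, qhom_ideal a b I
      & forall d, quot_dim (qhom a b d) (I `&` qhom a b d) (H d)]].

Definition qhilb (a b n : nat) (H : nat -> nat) : charted F :=
  subvariety (@qhilb_set a b n H).

Definition nested_set (k : nat) (n : 'I_k -> nat) :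
    set (product_variety (fun i => hilb (n i))) :=
  [set I : forall i, hilb_pt (n i) |
    forall j h : 'I_k, (j < h)%N -> I j `<=` I h].

Definition nested_qhilb (a b k : nat) (n : 'I_k -> nat)
    (H : 'I_k -> nat -> nat) : charted F :=
  subvariety (@nested_set k n `&`
    [set I : forall i, hilb_pt (n i) |
      forall i, @qhilb_set a b (n i) (H i) (I i)]).

End Hilbert.

(* The value of the sum of all d_j is n; in particular almost all d_j vanish. *)
Definition sums_to (d : nat -> nat) (n : nat) : Prop :=
  exists N : nat, forall M : nat, (N <= M)%N -> (\sum_(j < M) d j = n)%N.

(* Main.v *)
From HB Require Import structures.
Require Import Defs.
From mathcomp Require Import all_boot all_order all_algebra.
From mathcomp Require Import boolp classical_sets reals.
From mathcomp Require Import mpoly complex.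

(* With u = x^k and v = y, a polynomial is uniquely a sum of x^i g_i(u, v) over
   0 <= i < k.  An ideal J that is homogeneous for the weights (1, k) is in this
   way a direct sum of x^i J_i(u, v), where J_0, ..., J_(k-1) are homogeneous
   ideals for the weights (1, 1) such that J_0 <= ... <= J_(k-1) and
   u J_(k-1) <= J_0, and the Hilbert function of J interleaves those of the J_i.
   The last inclusion is automatic: in a degree of E all J_i agree, and of two
   consecutive degrees at least one is in E.  This is an isomorphism because
   monomials form a basis modulo J if and only if, sorted by the class of their
   x-exponent modulo k, they form bases modulo the J_i; so the charts
   correspond, and each coordinate is either a coordinate or zero. *)

Set Implicit Arguments.
Unset Strict Implicit.
Unset Printing Implicit Defensive.

Import GRing.Theory.
Local Open Scope ring_scope.
Local Open Scope classical_set_scope.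

Local Notation coord := Defs.coord.

(** * Morphisms of charted spaces *)

Section Morphisms.
Variable F : fieldType.

Lemma polynomial_on_const (X : charted F) (c : chart X) (a : F) :
  polynomial_on c (fun=> a).
Proof.
exists 0%N, (fun i : 'I_0 => False_rect _ (notF (ltn_ord i))), a%:MP => x.
by rewrite mevalC.
Qed.

Lemma polynomial_on_coord (X : charted F) (c : chart X) (v : cvar c) :
  polynomial_on c (coord v).
Proof. by exists 1%N, (fun=> v), 'X_ord0 => x; rewrite mevalXU. Qed.

(** Concatenating the two lists of coordinates puts both functions over one polynomial ring, where
    they can be added and multiplied. *)
Lemma polynomial_on_pair (X : charted F) (c : chart X) (f g : X -> F) :
    polynomial_on c f -> polynomial_on c g ->
  exists m (v : 'I_m -> cvar c) (P Q : {mpoly F[m]}), forall x,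
    f x = P.@[fun i => coord (v i) x] /\ g x = Q.@[fun i => coord (v i) x].
Proof.
move=> [m1 [v1 [P fE]]] [m2 [v2 [Q gE]]].
exists (m1 + m2)%N.
exists (fun i => match split i with inl i1 => v1 i1 | inr i2 => v2 i2 end).
exists (P \mPo [tuple 'X_(lshift m2 i) | i < m1]).
exists (Q \mPo [tuple 'X_(rshift m1 i) | i < m2]) => x.
rewrite !comp_mpoly_meval fE gE; split; apply: meval_eq => i.
  by rewrite tnth_mktuple mevalXU (unsplitK (inl i : 'I_m1 + 'I_m2)).
by rewrite tnth_mktuple mevalXU (unsplitK (inr i : 'I_m1 + 'I_m2)).
Qed.

Lemma polynomial_onD (X : charted F) (c : chart X) (f g : X -> F) :
  polynomial_on c f -> polynomial_on c g -> polynomial_on c (fun x => f x + g x).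
Proof.
move=> pf /(polynomial_on_pair pf) [m [v [P [Q fgE]]]].
by exists m, v, (P + Q) => x; rewrite mevalD; case: (fgE x) => -> ->.
Qed.

Lemma polynomial_onM (X : charted F) (c : chart X) (f g : X -> F) :
  polynomial_on c f -> polynomial_on c g -> polynomial_on c (fun x => f x * g x).
Proof.
move=> pf /(polynomial_on_pair pf) [m [v [P [Q fgE]]]].
by exists m, v, (P * Q) => x; rewrite mevalM; case: (fgE x) => -> ->.
Qed.

Lemma polynomial_on_meval (X : charted F) (c : chart X) m (P : {mpoly F[m]})
    (g : 'I_m -> X -> F) :
  (forall i, polynomial_on c (g i)) ->
  polynomial_on c (fun x => P.@[fun i => g i x]).
Proof.
move=> pg; under eq_fun do rewrite mevalE.
elim: (msupp P) => [|u s IHs].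
  by under eq_fun do rewrite big_nil; exact: polynomial_on_const.
under eq_fun do rewrite big_cons.
apply: polynomial_onD => //; apply: polynomial_onM.
  exact: polynomial_on_const.
elim: (index_enum _) => [|i t IHt].
  by under eq_fun do rewrite big_nil; exact: polynomial_on_const.
under eq_fun do rewrite big_cons.
apply: polynomial_onM => //; elim: (u i) => [|e IHe].
  by under eq_fun do rewrite expr0; exact: polynomial_on_const.
by under eq_fun do rewrite exprS; exact: polynomial_onM.
Qed.

(** If coordinates pull back to polynomials on a smaller chart, then so do all polynomials, by
    substitution. Hence basic open sets pull back to open sets and local fractions to local
    fractions. The equations are asked for on [cdom c'] only, since coordinates are arbitrary
    elsewhere. *)
Lemma morphism_of_charts (X Y : charted F) (phi : X -> Y) :
    (forall x (c : chart Y), cdom c (phi x) -> exists c' : chart X,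
      [/\ cdom c' x, forall y, cdom c' y -> cdom c (phi y)
        & forall v : cvar c, exists p, polynomial_on c' p /\
            forall y, cdom c' y -> coord v (phi y) = p y]) ->
  morphism phi.
Proof.
move=> hphi.
have pull (c : chart Y) (c' : chart X) (p : Y -> F) :
    (forall v : cvar c, exists q, polynomial_on c' q /\
       forall y, cdom c' y -> coord v (phi y) = q y) ->
    polynomial_on c p ->
    exists q, polynomial_on c' q /\ forall y, cdom c' y -> p (phi y) = q y.
  move=> /choice[q hq] [m [v [P pE]]].
  exists (fun x => P.@[fun i => q (v i) x]); split.
    by apply: polynomial_on_meval => i; case: (hq (v i)).
  by move=> y cy; rewrite pE; apply: meval_eq => i; case: (hq (v i)) => _ ->.
move=> V oV; split=> [x Vx | f rf x Vx].
  have [c [q [pq cx qx qV]]] := oV _ Vx.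
  have [c' [c'x c'c cv]] := hphi _ _ cx.
  have [q' [pq' qq']] := pull _ _ _ cv pq.
  exists c', q'; split=> //; first by rewrite -qq'.
  by move=> y c'y; rewrite -qq' // => qy; apply: qV => //; exact: c'c.
have [c [p [q [pp pq cx qx qV]]]] := rf _ Vx.
have [c' [c'x c'c cv]] := hphi _ _ cx.
have [p' [pp' pp'E]] := pull _ _ _ cv pp.
have [q' [pq' qq']] := pull _ _ _ cv pq.
exists c', p', q'; split=> //; first by rewrite -qq'.
move=> y Vy c'y; rewrite -qq' // => qy.
by rewrite /= (qV _ Vy (c'c _ c'y) qy) pp'E.
Qed.

End Morphisms.

(** * Bases of quotients *)

Section QuotientBases.
Variable F : fieldType.

Definition subspace (L : lmodType F) (W : set L) : Prop :=
  W 0 /\ forall (a : F) u v, W u -> W v -> W (a *: u + v).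

Section Subspace.
Variables (L : lmodType F) (W : set L).
Hypothesis sW : subspace W.

Lemma subspaceZ a u : W u -> W (a *: u).
Proof. by case: sW => W0 Wl Wu; rewrite -[_ *: _]addr0; exact: Wl. Qed.

Lemma subspaceD u v : W u -> W v -> W (u + v).
Proof. by case: sW => W0 Wl Wu; rewrite -[u in W (u + _)]scale1r; exact: Wl. Qed.

Lemma subspaceB u v : W u -> W v -> W (u - v).
Proof.
by move=> Wu Wv; apply: subspaceD => //; rewrite -scaleN1r; exact: subspaceZ.
Qed.

Lemma subspace_sum (I : Type) (r : seq I) (P : pred I) (f : I -> L) :
  (forall i, P i -> W (f i)) -> W (\sum_(i <- r | P i) f i).
Proof.
by move=> Wf; apply: (big_ind W) => //; [case: sW | exact: subspaceD].
Qed.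

End Subspace.

Lemma combination_mulmx (L : lmodType F) n n' (e : 'I_n -> L) (e' : 'I_n' -> L)
    (B : 'M[F]_(n, n')) (c : 'rV[F]_n) v :
  v - \sum_j (c *m B) 0 j *: e' j = (v - \sum_i c 0 i *: e i) +
    \sum_i c 0 i *: (e i - \sum_j B i j *: e' j).
Proof.
rewrite [X in _ = _ + X](eq_bigr _ (fun i _ => scalerBr _ _ _)).
rewrite big_split /= addrA subrK sumrN; congr (_ - _).
rewrite [RHS](eq_bigr _ (fun i _ => scaler_sumr _ _ _ _)).
rewrite exchange_big /=; apply: eq_bigr => j _.
by rewrite mxE scaler_suml; apply: eq_bigr => i _; rewrite scalerA.
Qed.

(* A matrix expressing one family in terms of the other composes with its
   counterpart to the identity, so the two families are equally long. *)
Lemma change_of_basis (L : lmodType F) (V W W' : set L) n n'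
    (e : 'I_n -> L) (e' : 'I_n' -> L) :
    subspace W' -> W `<=` W' -> quot_basis V W e -> quot_basis V W' e' ->
  exists (A : 'M[F]_(n', n)) (B : 'M[F]_(n, n')), A *m B = 1%:M /\
    forall i, W' (e i - \sum_j B i j *: e' j).
Proof.
move=> sW' WW' [Ve be] [Ve' be'].
have /choice[A hA] : forall i, exists c : 'rV[F]_n,
    W (e' i - \sum_j c 0 j *: e j).
  by move=> i; have [c [hc _]] := be _ (Ve' i); exists c.
have /choice[B hB] : forall i, exists c : 'rV[F]_n',
    W' (e i - \sum_j c 0 j *: e' j).
  by move=> i; have [c [hc _]] := be' _ (Ve i); exists c.
exists (\matrix_(i, j) A i 0 j), (\matrix_(i, j) B i 0 j); split; last first.
  by move=> i; under eq_bigr do rewrite mxE; exact: hB.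
apply/row_matrixP => i.
have [c [_ uc]] := be' _ (Ve' i).
(* Row i of the product and the i-th unit row both express [e' i] modulo [W'], so both equal the
   unique row [c]. *)
rewrite -[LHS](uc) -?[RHS](uc) //.
  under eq_bigr => j _ do rewrite !mxE.
  rewrite (bigD1 i) //= eqxx scale1r big1 ?addr0 ?subrr; first by case: sW'.
  by move=> j ji; rewrite eq_sym (negPf ji) scale0r.
rewrite row_mul (combination_mulmx e); apply: (subspaceD sW').
  by apply: WW'; under eq_bigr do rewrite !mxE; exact: hA.
apply: (subspace_sum sW') => l _; apply: (subspaceZ sW').
by under eq_bigr do rewrite mxE; exact: hB.
Qed.

Lemma quot_dim_unique (L : lmodType F) (V W : set L) n n' :
  subspace W -> quot_dim V W n -> quot_dim V W n' -> n = n'.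
Proof.
move=> sW [e be] [e' be']; apply/eqP; rewrite eqn_leq; apply/andP; split.
  by have [A [B [/mulmx1_min]]] := change_of_basis sW (@subset_refl _ W) be' be.
by have [A [B [/mulmx1_min]]] := change_of_basis sW (@subset_refl _ W) be be'.
Qed.

(** The projection from V / W onto V / W' has a square matrix [B] with a one-sided, hence two-sided,
    inverse. It is therefore injective: an element of [W'] has coordinates [c] modulo [W] with
    [c *m B = 0], so [c = 0]. *)
Lemma quot_dim_subset (L : lmodType F) (V W W' : set L) n :
    subspace W -> subspace W' -> W `<=` W' ->
    quot_dim V W n -> quot_dim V W' n ->
  V `&` W' `<=` W.
Proof.
move=> sW sW' WW' [e be] [e' be'] w [Vw W'w].
have [A [B [/mulmx1C BA hB]]] := change_of_basis sW' WW' be be'.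
have [c [hc _]] := be.2 _ Vw.
suff c0 : c = 0.
  by move: hc; rewrite c0 big1 ?subr0 // => i _; rewrite mxE scale0r.
suff cB : c *m B = 0 by rewrite -[c]mulmx1 -BA mulmxA cB mul0mx.
have [c' [_ uc]] := be'.2 _ Vw; rewrite -(uc 0) ?(uc (c *m B)) //.
  rewrite (combination_mulmx e).
  apply: (subspaceD sW'); first exact: WW'.
  by apply: (subspace_sum sW') => l _; apply: (subspaceZ sW').
by rewrite big1 ?subr0 // => i _; rewrite mxE scale0r.
Qed.

(** The map [f] induces an isomorphism from V / W to V' / W': it is onto because of the section [g],
    and injective because within [V] the preimage of [W'] is [W]. *)
Lemma quot_dim_transfer (L L' : lmodType F) (V W : set L) (V' W' : set L') n
    (f : {linear L -> L'}) (g : L' -> L) :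
    subspace V -> (forall v, V v -> V' (f v)) -> (forall v', V' v' -> V (g v')) ->
    (forall v', V' v' -> f (g v') = v') ->
    (forall v, V v -> W v <-> W' (f v)) ->
  quot_dim V W n -> quot_dim V' W' n.
Proof.
move=> sV fV gV fg fW [e [Ve be]]; exists (f \o e); split=> [i | v' Vv'].
  exact/fV.
have E (c : 'rV[F]_n) : W (g v' - \sum_i c 0 i *: e i) <->
    W' (v' - \sum_i c 0 i *: (f \o e) i).
  rewrite fW; last first.
    apply: (subspaceB sV); first exact: gV.
    by apply: (subspace_sum sV) => i _; exact: (subspaceZ sV).
  rewrite linearB fg // (linear_sum f).
  by under [in X in W' (_ - X)]eq_bigr do rewrite linearZ.
have [c [hc uc]] := be _ (gV _ Vv'); exists c.
by split=> [|c']; rewrite -E //; exact: uc.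
Qed.

(** * Bases of a quotient that is a direct sum *)

Section DirectSum.
Variables (L L' : lmodType F) (k N : nat) (n : 'I_k -> nat).
Variables (s : forall i, 'I_(n i) -> 'I_N).
Hypothesis s_bij :
  bijective (fun u : {i : 'I_k & 'I_(n i)} => s (tagged u)).
Variables (p : 'I_k -> {linear L -> L'}).
Variables (W : set L) (V' W' : 'I_k -> set L').
Variables (e : 'I_N -> L) (e' : forall i, 'I_(n i) -> L').
Hypothesis W_split : forall v, W v <-> forall i, W' i (p i v).
Hypothesis pV' : forall i v, V' i (p i v).
Hypothesis p_diag : forall i (j : 'I_(n i)), p i (e (s j)) = e' j.
Hypothesis p_offdiag :
  forall i i' (j : 'I_(n i')), i' != i -> p i (e (s j)) = 0.

(** Each [e (s j)] is seen by the projection of its own block only, so one relation modulo [W]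
    decouples into k independent relations. *)
Lemma direct_sum_coef v (c : 'I_N -> F) :
  W (v - \sum_t c t *: e t) <->
  forall i, W' i (p i v - \sum_(j < n i) c (s j) *: e' j).
Proof.
suff E i : p i (v - \sum_t c t *: e t) =
    p i v - \sum_(j < n i) c (s j) *: e' j.
  by rewrite W_split; split=> h i; have := h i; rewrite E.
rewrite linearB (linear_sum (p i)); congr (_ - _).
rewrite (reindex _ (onW_bij _ s_bij)) /=.
pose G i' (j : 'I_(n i')) := p i (c (s j) *: e (s j)).
transitivity (\sum_i \sum_j G i j).
  by rewrite (sig_big_dep xpredT (fun=> xpredT) G).
rewrite (bigD1 i) //= [X in _ + X]big1.
  by rewrite addr0; apply: eq_bigr => j _; rewrite /G linearZ /= p_diag.
move=> i' i'i; rewrite big1 // => j _.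
by rewrite /G linearZ /= p_offdiag ?scaler0.
Qed.

Lemma direct_sum_basis :
  (forall i, quot_basis (V' i) (W' i) (@e' i)) -> quot_basis setT W e.
Proof.
move=> be'; split=> // v _.
have [c hc] : exists c : forall i, 'rV[F]_(n i),
    forall i, W' i (p i v - \sum_j c i 0 j *: e' j).
  have h i : exists c : 'rV[F]_(n i), W' i (p i v - \sum_j c 0 j *: e' j).
    by have [c [hc _]] := (be' i).2 _ (pV' i v); exists c.
  by exists (fun i => projT1 (cid (h i))) => i; exact: projT2 (cid (h i)).
have [s' sK s'K] := s_bij.
have {}sK i (j : 'I_(n i)) : s' (s j) = Tagged (fun i => 'I_(n i)) j.
  exact: (sK (Tagged (fun i => 'I_(n i)) j)).
exists (\row_t c (tag (s' t)) 0 (tagged (s' t))); split.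
  apply/(direct_sum_coef v (fun t => _)) => i.
  by under eq_bigr do rewrite mxE sK; exact: hc.
move=> c' /(direct_sum_coef v (fun t => c' 0 t)) hc'.
apply/rowP => t; rewrite -[t]s'K mxE sK; case: (s' t) => i j /=.
have [c0 [_ uc0]] := (be' i).2 _ (pV' i v).
rewrite -(uc0 _ (hc i)) (uc0 (\row_j c' 0 (s j))) ?mxE //.
by under eq_bigr do rewrite mxE; exact: hc'.
Qed.

Lemma direct_sum_basis_component (q : 'I_k -> L' -> L) :
    (forall i v, V' i v -> p i (q i v) = v) ->
    (forall i (j : 'I_(n i)), V' i (e' j)) ->
  quot_basis setT W e -> forall i, quot_basis (V' i) (W' i) (@e' i).
Proof.
move=> pq Ve' [_ be] i; split=> // v Vv.
have [c [/[dup] hc /(direct_sum_coef _ (fun t => c 0 t)) hc' uc]] :=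
  be (q i v) I.
exists (\row_j c 0 (s j)); split.
  by have := hc' i; rewrite pq //; under [in X in _ -> X]eq_bigr do rewrite mxE.
move=> c1 hc1; have [s' sK s'K] := s_bij.
have {}sK i' (j : 'I_(n i')) : s' (s j) = Tagged (fun i => 'I_(n i)) j.
  exact: (sK (Tagged (fun i => 'I_(n i)) j)).
(* Coefficients [c1] on block i, and those of [c] as default on the other blocks; uniqueness of [c]
   then forces [c2] to agree with it. *)
pose c2 t := untag (c 0 t) (fun j : 'I_(n i) => c1 0 j) (s' t).
suff /uc cE : W (q i v - \sum_t (\row_t c2 t) 0 t *: e t).
  by apply/rowP => j; rewrite cE !mxE /c2 sK untagE.
apply/(direct_sum_coef _ (fun t => _)) => i'.
have [<-|i'i] := eqVneq i i'.
  rewrite pq //; under eq_bigr do rewrite mxE /c2 sK untagE.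
  exact: hc1.
under eq_bigr do rewrite mxE /c2 sK untag_dflt 1?eq_sym //.
exact: hc'.
Qed.

End DirectSum.

Lemma rank_tagged_bij k (n : 'I_k -> nat) :
  bijective (fun u : {i : 'I_k & 'I_(n i)} =>
    tagnat.rank (Tagged (fun i => 'I_(n i)) (tagged u))).
Proof.
have [s' sK s'K] := @tagnat.rank_bij _ n.
by exists s' => [[i j]|t]; rewrite ?sK // -[RHS]s'K; case: (s' t).
Qed.

(** Bases of the components are lifted by the maps [q i] and concatenated; [tagnat] numbers the
    pairs of a block and a position in it. *)
Lemma direct_sum_quot_dim (L L' : lmodType F) k (n : 'I_k -> nat)
    (p : 'I_k -> {linear L -> L'}) (q : 'I_k -> L' -> L)
    (W : set L) (V' W' : 'I_k -> set L') :
    (forall v, W v <-> forall i, W' i (p i v)) ->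
    (forall i v, V' i (p i v)) ->
    (forall i v, V' i v -> p i (q i v) = v) ->
    (forall i i' v, V' i' v -> i' != i -> p i (q i' v) = 0) ->
    (forall i, quot_dim (V' i) (W' i) (n i)) ->
  quot_dim setT W (\sum_(i < k) n i).
Proof.
move=> W_split pV' pq pq0 dimW.
pose e' i : 'I_(n i) -> L' := projT1 (cid (dimW i)).
have be' i : quot_basis (V' i) (W' i) (@e' i) := projT2 (cid (dimW i)).
pose s i (j : 'I_(n i)) := tagnat.rank (Tagged (fun i => 'I_(n i)) j).
pose e t := let u := tagnat.sig t in q (tag u) (@e' (tag u) (tagged u)).
have es i (j : 'I_(n i)) : e (s i j) = q i (e' i j).
  by rewrite /e /s /= tagnat.rankK.
exists e; apply: (@direct_sum_basis _ _ _ _ n s _ p _ V' W' _ e') => //.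
- exact: rank_tagged_bij.
- by move=> i j; rewrite es pq //; have [] := be' i.
- by move=> i i' j i'i; rewrite es pq0 //; have [] := be' i'.
Qed.

End QuotientBases.

(** * Quasi-homogeneous polynomials *)

Section Polynomials.
Variable F : fieldType.
Local Notation poly2 := {mpoly F[2]}.
Local Notation mon := 'X_{1..2}.

(** The hypothesis says that [m0] is the only monomial selected by [P] that [g] sends to [m]. This
    covers both [qhom_part], with the identity for [g], and the component map [part] below. *)
Lemma mcoeff_monomial_sum (f : poly2) (P : pred mon) (g : mon -> mon) m m0 :
    (forall m', P m' && (g m' == m) = (m' == m0)) ->
  (\sum_(m' <- msupp f | P m') f@_m' *: 'X_[g m'])@_m = f@_m0.
Proof.
move=> gP; rewrite raddf_sum /=.
under eq_bigr do rewrite mcoeffZ mcoeffX mulr_natr mulrb.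
rewrite -big_mkcondr /=; under eq_bigl do rewrite gP.
have [m0f|m0f] := boolP (m0 \in msupp f).
  by rewrite -big_filter filter_pred1_uniq ?big_seq1 ?msupp_uniq.
rewrite memN_msupp_eq0 // big_seq_cond big1 // => m' /andP[m'f /eqP m'm0].
by rewrite m'm0 (negPf m0f) in m'f.
Qed.

Lemma eq_linear_mpoly (L : lmodType F) (f g : {linear poly2 -> L}) :
  (forall m, f 'X_[m] = g 'X_[m]) -> f =1 g.
Proof.
move=> fg p; rewrite [p]mpolyE !linear_sum; apply: eq_bigr => m _.
by rewrite !linearZ fg.
Qed.

Lemma mcoeff_qhom_part a b d (f : poly2) m :
  (qhom_part a b d f)@_m = if wdeg a b m == d then f@_m else 0.
Proof.
rewrite /qhom_part; case: eqVneq => wm.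
  rewrite (mcoeff_monomial_sum (g := id) f (m0 := m)) // => m'.
  by case: (eqVneq m' m) => [->|]; rewrite ?wm ?eqxx ?andbF.
rewrite raddf_sum big1 //= => m' /eqP wm'; rewrite mcoeffZ mcoeffX.
have [m'm|_] := eqVneq m' m; last by rewrite mulr0.
by rewrite -wm' m'm eqxx in wm.
Qed.

Fact qhom_part_is_linear a b d : linear (@qhom_part F a b d).
Proof.
move=> c f g; apply/mpolyP=> m.
by rewrite mcoeffD mcoeffZ !mcoeff_qhom_part mcoeffD mcoeffZ; case: ifP;
  rewrite // mulr0 addr0.
Qed.

HB.instance Definition _ a b d :=
  GRing.isLinear.Build F poly2 poly2 *:%R (@qhom_part F a b d)
    (qhom_part_is_linear a b d).

Lemma qhomP a b d (f : poly2) :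
  qhom a b d f <-> forall m, f@_m != 0 -> wdeg a b m = d.
Proof. by split=> hf m; have := hf m; rewrite mcoeff_msupp. Qed.

Lemma qhom_part_qhom a b d (f : poly2) : qhom a b d (qhom_part a b d f).
Proof.
by apply/qhomP => m; rewrite mcoeff_qhom_part; case: (eqVneq _ d); rewrite ?eqxx.
Qed.

Lemma qhom_part_id a b d (f : poly2) : qhom a b d f -> qhom_part a b d f = f.
Proof.
move=> /qhomP hf; apply/mpolyP => m; rewrite mcoeff_qhom_part.
case: (eqVneq _ d) => // wm; apply/esym/eqP; apply: contraNT wm.
by move/hf => ->.
Qed.

Lemma qhom_part_neq a b d d' (f : poly2) :
  qhom a b d f -> d != d' -> qhom_part a b d' f = 0.
Proof.
move=> /qhomP hf dd'; apply/mpolyP => m; rewrite mcoeff_qhom_part mcoeff0.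
case: (eqVneq _ d') => // wm; apply/eqP; apply: contraNT dd'.
by move/hf; rewrite wm => ->.
Qed.

Lemma sum_qhom_part a b (f : poly2) :
  exists M, forall M', (M <= M')%N -> f = \sum_(d < M') qhom_part a b d f.
Proof.
exists (\max_(m <- msupp f) wdeg a b m).+1 => M' leM; apply/mpolyP => m.
rewrite raddf_sum /=; under eq_bigr do rewrite mcoeff_qhom_part.
have [mf|mf] := boolP (m \in msupp f).
  have wM : (wdeg a b m < M')%N.
    by apply: leq_trans leM; rewrite ltnS; exact: leq_bigmax_seq.
  rewrite (bigD1 (Ordinal wM)) //= eqxx big1 ?addr0 // => d.
  by rewrite -val_eqE /= eq_sym => /negPf ->.
rewrite memN_msupp_eq0 // big1 // => d _.
by case: ifP.
Qed.

End Polynomials.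

(** * The decomposition of polynomials by the exponent of x modulo k *)

Section Decomposition.
Variables (F : fieldType) (k : nat) (k_gt0 : (0 < k)%N).
Local Notation poly2 := {mpoly F[2]}.
Local Notation mon := 'X_{1..2}.
Local Notation x := (varx F).
Local Notation y := (vary F).

(** The exponent of x^i m(x^k, y). For i < k, [mon_class] recovers i and [mon_low] recovers m, by
    Euclidean division of the x-exponent. *)
Definition mon_up (i : nat) (m : mon) : mon :=
  [multinom (if j == ord0 then i + k * m ord0 else m ord_max)%N | j < 2].

Definition mon_low (m : mon) : mon :=
  [multinom (if j == ord0 then m ord0 %/ k else m ord_max)%N | j < 2].

Definition mon_class (m : mon) : 'I_k := Ordinal (ltn_pmod (m ord0) k_gt0).

Lemma mon2P (m m' : mon) :
  m ord0 = m' ord0 -> m ord_max = m' ord_max -> m = m'.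
Proof.
move=> m0 m1; apply/mnmP => i; have [->|] := eqVneq i ord0; first by [].
by case: i => -[|[|//]] // hi _; rewrite (_ : Ordinal hi = ord_max) //;
  apply: val_inj.
Qed.

Lemma mon_up0 i m : mon_up i m ord0 = (i + k * m ord0)%N.
Proof. by rewrite mnmE. Qed.

Lemma mon_up1 i m : mon_up i m ord_max = m ord_max.
Proof. by rewrite mnmE. Qed.

Lemma mon_lowK m : mon_up (mon_class m) (mon_low m) = m.
Proof.
apply: mon2P; rewrite ?mon_up0 ?mon_up1 !mnmE //=.
by rewrite addnC mulnC -divn_eq.
Qed.

Lemma mon_class_up (i : 'I_k) m : mon_class (mon_up i m) = i.
Proof.
by apply: val_inj; rewrite /= mon_up0 addnC mulnC modnMDl modn_small.
Qed.

Lemma mon_upK (i : 'I_k) : cancel (mon_up i) mon_low.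
Proof.
move=> m; apply: mon2P; rewrite !mnmE //=.
by rewrite addnC mulnC divnMDl // divn_small ?addn0.
Qed.

(** Both x^k and y have weight k, which is why the Hilbert functions of the components are
    interleaved in that of the whole ideal. *)
Lemma wdeg_mon_up i m : wdeg 1 k (mon_up i m) = (i + k * wdeg 1 1 m)%N.
Proof. by rewrite /wdeg mon_up0 mon_up1 !mul1n mulnDr addnA. Qed.

(** This is x^i g(x^k, y). The exponent i is not bounded by k, so that products can be written
    before their exponent is reduced modulo k. *)
Definition emb (i : nat) (g : poly2) : poly2 :=
  x ^+ i * (g \mPo [tuple x ^+ k; y]).

(* The polynomial g such that the monomials x^j y^l of f with j = i modulo k
   sum up to x^i g(x^k, y). *)
Definition part (i : 'I_k) (f : poly2) : poly2 :=
  \sum_(m <- msupp f | mon_class m == i) f@_m *: 'X_[mon_low m].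

Lemma mcoeff_part i f m : (part i f)@_m = f@_(mon_up i m).
Proof.
apply: mcoeff_monomial_sum => m'.
apply/andP/eqP => [[/eqP <- /eqP <-]|->]; first by rewrite mon_lowK.
by rewrite mon_class_up mon_upK !eqxx.
Qed.

Fact part_is_linear i : linear (part i).
Proof.
by move=> c f g; apply/mpolyP => m; rewrite mcoeffD mcoeffZ !mcoeff_part
  mcoeffD mcoeffZ.
Qed.

HB.instance Definition _ i :=
  GRing.isLinear.Build F poly2 poly2 *:%R (part i) (part_is_linear i).

Fact emb_is_linear i : linear (emb i).
Proof. by move=> c f g; rewrite /emb linearP mulrDr scalerAr. Qed.

HB.instance Definition _ i :=
  GRing.isLinear.Build F poly2 poly2 *:%R (emb i) (emb_is_linear i).

Lemma embX i m : emb i 'X_[m] = 'X_[mon_up i m].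
Proof.
rewrite /emb comp_mpolyX !mpolyXE_id !big_ord_recl !big_ord0 !mulr1.
rewrite mon_up0 (_ : lift ord0 ord0 = ord_max) ?mon_up1; last exact: val_inj.
by rewrite mulrA exprD exprM.
Qed.

Lemma embM i j f g : emb (i + j) (f * g) = emb i f * emb j g.
Proof. by rewrite /emb rmorphM exprD mulrACA. Qed.

(** The carry: a surplus factor x^k is the first variable u of the component, there written [x]. *)
Lemma emb_addk i f : emb (i + k) f = emb i (x * f).
Proof.
rewrite /emb rmorphM /= exprD -mulrA; congr (_ * (_ * _)).
by rewrite /varx comp_mpolyXU.
Qed.

Lemma part_inj f g : (forall i, part i f = part i g) -> f = g.
Proof.
move=> fg; apply/mpolyP => m.
by rewrite -(mon_lowK m) -!mcoeff_part fg.
Qed.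

Lemma partX i m : part i 'X_[m] = if mon_class m == i then 'X_[mon_low m] else 0.
Proof.
apply/mpolyP => m'; rewrite mcoeff_part mcoeffX.
have [<-|ci] := eqVneq (mon_class m) i.
  rewrite mcoeffX; congr ((nat_of_bool _)%:R); apply/eqP/eqP => [E|<-].
    by rewrite E mon_upK.
  by rewrite mon_lowK.
rewrite mcoeff0; case: eqVneq => // E.
by rewrite E mon_class_up eqxx in ci.
Qed.

Lemma part_emb (i j : 'I_k) g : part i (emb j g) = if j == i then g else 0.
Proof.
have [->|ji] := eqVneq j i.
  apply: (eq_linear_mpoly (f := part i \o emb i) (g := idfun)) => m /=.
  by rewrite embX partX mon_class_up eqxx mon_upK.
apply: (eq_linear_mpoly (f := part i \o emb j) (g := \0)) => m /=.
by rewrite embX partX mon_class_up (negPf ji).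
Qed.

Lemma sum_emb_part f : f = \sum_(i < k) emb i (part i f).
Proof.
apply: part_inj => j; rewrite linear_sum (bigD1 j) //= part_emb eqxx.
by rewrite big1 ?addr0 // => i ij; rewrite part_emb (negPf ij).
Qed.

Lemma part_qhom_part (i : 'I_k) j (e : 'I_k) f :
  part i (qhom_part 1 k (e + k * j) f) =
  if e == i then qhom_part 1 1 j (part i f) else 0.
Proof.
apply/mpolyP => m; rewrite mcoeff_part mcoeff_qhom_part wdeg_mon_up.
(* Uniqueness of Euclidean division by k, as i and e are both below k. *)
have E w : (i + k * w == e + k * j)%N = (e == i) && (w == j).
  apply/eqP/andP => [E|[/eqP -> /eqP ->]] //.
  have ei : e = i.
    apply: val_inj; have /(congr1 (modn^~ k)) := E.
    by rewrite ![(_ + k * _)%N]addnC ![(k * _)%N]mulnC !modnMDl !modn_small.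
  move: E; rewrite ei eqxx => /addnI /eqP.
  by rewrite eqn_pmul2l.
rewrite E; case: ifP => [/andP[-> /eqP <-]|].
  by rewrite mcoeff_qhom_part eqxx mcoeff_part.
by case: eqVneq => /=; rewrite ?mcoeff0 // mcoeff_qhom_part => _ ->.
Qed.

Lemma emb_qhom_part (i : 'I_k) j g :
  emb i (qhom_part 1 1 j g) = qhom_part 1 k (i + k * j) (emb i g).
Proof.
apply: part_inj => c; rewrite part_qhom_part !part_emb.
by case: ifP; rewrite ?linear0.
Qed.

(** For the weights (1, k) the degree and the x-exponent agree modulo k, so all monomials of [f] are
    in class i. *)
Lemma emb_part_qhom (i : 'I_k) j f :
  qhom 1 k (i + k * j) f -> emb i (part i f) = f.
Proof.
move=> /qhom_part_id <-; apply: part_inj => c.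
by rewrite part_emb !part_qhom_part eqxx; case: eqVneq => [->|].
Qed.

Lemma emb_qhom (i : 'I_k) j g : qhom 1 1 j g -> qhom 1 k (i + k * j) (emb i g).
Proof. by move/qhom_part_id <-; rewrite emb_qhom_part; exact: qhom_part_qhom. Qed.

Lemma part_qhom (i : 'I_k) j f : qhom 1 k (i + k * j) f -> qhom 1 1 j (part i f).
Proof.
move=> /qhom_part_id <-; rewrite part_qhom_part eqxx; exact: qhom_part_qhom.
Qed.

Lemma modk_eq d : exists (i : 'I_k) j, d = (i + k * j)%N.
Proof.
exists (Ordinal (ltn_pmod d k_gt0)), (d %/ k)%N.
by rewrite /= addnC mulnC -divn_eq.
Qed.

End Decomposition.

(** * Ideals *)

Section Ideals.
Variable F : fieldType.
Local Notation poly2 := {mpoly F[2]}.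
Local Notation mon := 'X_{1..2}.

Lemma ideal_ext (I J : ideal F) :
  (forall f, ideal_set I f <-> ideal_set J f) -> I = J.
Proof.
move=> IJ; have {}IJ : ideal_set I = J by apply/predeqP.
case: I J IJ => [I I0 ID IM] [J J0 JD JM] /= IJ.
move: I0 ID IM; rewrite IJ => I0 ID IM.
by congr Ideal; exact: Prop_irrelevance.
Qed.

Lemma ideal_subspace (I : ideal F) : subspace I.
Proof.
split=> [|a u v Iu Iv]; first exact: ideal_zero.
by apply: ideal_add => //; rewrite -mul_mpolyC; exact: ideal_mul.
Qed.

Lemma qhom_subspace a b d : subspace (@qhom F a b d).
Proof.
split=> [m|c u v qu qv]; first by rewrite msupp0.
rewrite -(qhom_part_id qu) -(qhom_part_id qv) -linearP.
exact: qhom_part_qhom.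
Qed.

Lemma ideal_qhom_subspace a b d (I : ideal F) : subspace (I `&` qhom a b d).
Proof.
have [[I0 Il] [q0 ql]] := (ideal_subspace I, qhom_subspace a b d).
by split=> // c u v [Iu qu] [Iv qv]; split; [exact: Il | exact: ql].
Qed.

Lemma qhom_mulx d (f : poly2) : qhom 1 1 d f -> qhom 1 1 d.+1 (varx F * f).
Proof.
move=> qf m; rewrite /varx mulrC (perm_mem (msuppMX f U_(ord0))).
case/mapP => m' /qf <- ->.
by rewrite /wdeg !mnmDE !mnm1E /= add0n !mul1n.
Qed.

Lemma torus_mpoly a b (t : F) (f : poly2) m :
  (f \mPo [tuple t ^+ a *: varx F; t ^+ b *: vary F])@_m =
  t ^+ wdeg a b m * f@_m.
Proof.
pose g : {linear poly2 -> poly2} :=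
  comp_mpoly [tuple t ^+ a *: varx F; t ^+ b *: vary F].
have gX m' : g 'X_[m'] = t ^+ wdeg a b m' *: 'X_[m'].
  rewrite /g /= comp_mpolyX !big_ord_recl big_ord0 mulr1 /=.
  rewrite (tnth_nth 0) (tnth_nth 0) /=.
  rewrite !exprZn -scalerAl -scalerAr scalerA -!exprM -exprD.
  rewrite [in RHS]mpolyXE_id !big_ord_recl big_ord0 mulr1.
  by rewrite (_ : lift ord0 ord0 = ord_max) //; exact: val_inj.
rewrite -[_ \mPo _]/(g f) [in LHS](mpolyE f) (linear_sum g) raddf_sum /=.
under eq_bigr do rewrite linearZZ gX /= !mcoeffZ mcoeffX mulrCA.
rewrite [in RHS](mpolyE f) raddf_sum mulr_sumr; apply: eq_bigr => m' _.
rewrite /= mcoeffZ mcoeffX; case: eqVneq => [->|_] //.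
by rewrite !mulr0.
Qed.

Lemma ideal_qhom_parts a b (I : ideal F) f :
  qhom_ideal a b I -> (ideal_set I f <-> forall d, ideal_set I (qhom_part a b d f)).
Proof.
move=> qI; split=> [If d|If]; first exact: qI.
have [M /(_ M (leqnn M)) ->] := sum_qhom_part a b f.
by apply: (subspace_sum (ideal_subspace I)) => d _.
Qed.

(** The torus element scales the part of degree d by the nonzero factor t^d, and membership in [I]
    is decided on the parts. *)
Lemma qhom_ideal_torus_fixed a b (I : ideal F) :
  qhom_ideal a b I -> torus_fixed a b I.
Proof.
move=> qI t t0; apply/predeqP => f; rewrite /torus_act /=.
set g := _ \mPo _.
have gE d : qhom_part a b d g = t ^+ d *: qhom_part a b d f.
  apply/mpolyP => m; rewrite mcoeffZ !mcoeff_qhom_part torus_mpoly.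
  by case: eqVneq => [->|_]; rewrite ?mulr0.
rewrite (ideal_qhom_parts g qI) (ideal_qhom_parts f qI).
split=> h d; have := h d; rewrite gE; last first.
  exact: (subspaceZ (ideal_subspace I)).
move=> /(subspaceZ (ideal_subspace I) (t ^- d)).
by rewrite scalerA mulVf ?scale1r // expf_neq0.
Qed.

(** The quotient is the direct sum of its graded pieces, almost all of them zero. This yields the
    colength of the components cut out of an ideal. *)
Lemma qhom_ideal_quot_dim a b (I : ideal F) (h : nat -> nat) n :
    qhom_ideal a b I -> sums_to h n ->
    (forall d, quot_dim (qhom a b d) (I `&` qhom a b d) (h d)) ->
  quot_dim setT I n.
Proof.
move=> qI [M hM] dimI; rewrite -(hM M (leqnn M)).
(* The partial sums of [h] are constant from M on, so [h d = 0] and all forms of degree d lie in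
   [I]. *)
have bigI d : (M <= d)%N -> qhom a b d `<=` I.
  move=> Md f qf; have hd0 : h d = 0%N.
    apply/eqP; rewrite -(eqn_add2l n) -{1}(hM d Md) addn0.
    by have := hM d.+1 (leqW Md); rewrite big_ord_recr /= => ->.
  have [e [_ /(_ f qf) [c [[If _] _]]]] := dimI d.
  rewrite big1 ?subr0 // in If => i _.
  by exfalso; have := ltn_ord i; rewrite [ltnRHS]hd0.
apply: (@direct_sum_quot_dim F _ _ M (fun d : 'I_M => h d)
  (fun d : 'I_M => qhom_part a b d) (fun=> id) _ (fun d : 'I_M => qhom a b d)
  (fun d : 'I_M => I `&` qhom a b d)) => //.
- move=> f; split=> [If d|If]; first by split; [exact: qI|exact: qhom_part_qhom].
  apply/(ideal_qhom_parts f qI) => d; have [dM|Md] := ltnP d M.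
    by have [] := If (Ordinal dM).
  exact/(bigI _ Md)/qhom_part_qhom.
- by move=> d f; exact: qhom_part_qhom.
- by move=> d f; exact: qhom_part_id.
- by move=> d d' f qf d'd; exact: qhom_part_neq qf d'd.
Qed.

(** Inside the chart the row of coefficients exists and is unique, so [xget] returns that row. *)
Lemma hilb_coordE n (B : 'I_n -> mon) (Z : hilb_pt F n) m (c : 'rV[F]_n) j :
    hilb_chart B Z ->
    ideal_set (sval Z) ('X_[m] - \sum_i c 0 i *: 'X_[B i]) ->
  hilb_coord B (m, j) Z = c 0 j.
Proof.
move=> [_ bB] hc; rewrite /hilb_coord (@xget_unique _ _ _ c) // => c' hc'.
have [c0 [_ uc]] := bB 'X_[m] I.
by rewrite -(uc _ hc) -(uc _ hc').
Qed.

Lemma hilb_coordP n (B : 'I_n -> mon) (Z : hilb_pt F n) m :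
    hilb_chart B Z ->
  ideal_set (sval Z) ('X_[m] - \sum_i hilb_coord B (m, i) Z *: 'X_[B i]).
Proof.
move=> cZ; have [c [hc _]] := cZ.2 'X_[m] I.
by under eq_bigr => i _ do rewrite (hilb_coordE i cZ hc).
Qed.

End Ideals.

(** * Splitting an ideal into its components *)

Section Splitting.
Variables (F : fieldType) (k : nat) (k_gt0 : (0 < k)%N).
Local Notation poly2 := {mpoly F[2]}.
Local Notation mon := 'X_{1..2}.
Local Notation x := (varx F).
Local Notation part := (part (F := F) k_gt0).
Local Notation emb := (emb (F := F) k).

(* J is the direct sum of the x^i I_i(x^k, y). *)
Definition splits (J : ideal F) (I : 'I_k -> ideal F) : Prop :=
  forall f, ideal_set J f <-> forall i, ideal_set (I i) (part i f).

Lemma splits_emb J I (i : 'I_k) g :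
  splits J I -> (ideal_set J (emb i g) <-> ideal_set (I i) g).
Proof.
move=> JI; rewrite JI; split=> [/(_ i)|Ig i']; rewrite part_emb ?eqxx //.
by case: eqVneq => [<-|_] //; exact: ideal_zero.
Qed.

Lemma splits_injl J J' I : splits J I -> splits J' I -> J = J'.
Proof. by move=> JI J'I; apply: ideal_ext => f; rewrite JI J'I. Qed.

Lemma splits_injr J I I' i : splits J I -> splits J I' -> I i = I' i.
Proof.
move=> JI JI'; apply: ideal_ext => f.
by rewrite -(splits_emb i f JI) (splits_emb i f JI').
Qed.

(** * Charts and coordinates of a split ideal *)

Section Basis.
Variables (n : 'I_k -> nat) (N : nat) (s : forall i, 'I_(n i) -> 'I_N).
Hypothesis s_bij :
  bijective (fun u : {i : 'I_k & 'I_(n i)} => s (tagged u)).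
Variables (B : 'I_N -> mon) (C : forall i, 'I_(n i) -> mon).
Hypothesis BC : forall i (j : 'I_(n i)), B (s j) = mon_up k i (C j).

Let part_diag i (j : 'I_(n i)) : part i 'X_[B (s j)] = 'X_[C j].
Proof. by rewrite BC -embX part_emb eqxx. Qed.

Let part_offdiag i i' (j : 'I_(n i')) : i' != i -> part i 'X_[B (s j)] = 0.
Proof. by move=> i'i; rewrite BC -embX part_emb (negPf i'i). Qed.

Lemma splits_chart (J : hilb_pt F N) (I : forall i, hilb_pt F (n i)) :
    splits (sval J) (fun i => sval (I i)) ->
  hilb_chart B J <-> forall i, hilb_chart (@C i) (I i).
Proof.
move=> JI; split=> [cJ | cI].
  apply: (direct_sum_basis_component s_bij JI part_diag part_offdiag
    (V' := fun=> setT) (q := fun i : 'I_k => emb i)) cJ => // i v _.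
  by rewrite /= part_emb eqxx.
exact: (direct_sum_basis s_bij (V' := fun=> setT)
  (W' := fun i => ideal_set (sval (I i))) JI (fun _ _ => Logic.I)
  part_diag part_offdiag cI).
Qed.

Lemma splits_coord (J : hilb_pt F N) (I : forall i, hilb_pt F (n i))
    m i (j : 'I_(n i)) :
    splits (sval J) (fun i => sval (I i)) -> hilb_chart B J ->
  hilb_coord B (m, s j) J =
  if mon_class k_gt0 m == i then hilb_coord (@C i) (mon_low k m, j) (I i) else 0.
Proof.
move=> JI cJ; have cI := (splits_chart JI).1 cJ i.
have := (direct_sum_coef s_bij
  (W' := fun i => ideal_set (sval (I i))) JI part_diag part_offdiag 'X_[m]
  (fun t => hilb_coord B (m, t) J)).1 (hilb_coordP m cJ) i.
rewrite /= partX; case: eqVneq => [_|_] h.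
  rewrite (hilb_coordE (c := \row_j hilb_coord B (m, s j) J) j cI) ?mxE //.
  by under eq_bigr do rewrite mxE.
(* The monomial has no component in class i, so the coefficients of this block express 0 in a basis
   and vanish. *)
have [c [_ uc]] := cI.2 0 Logic.I.
transitivity ((\row_j hilb_coord B (m, s j) J) 0 j); first by rewrite mxE.
rewrite -(uc (\row_j _)) ?(uc 0) ?mxE //.
  rewrite big1 ?subr0; first exact: ideal_zero.
  by move=> l _; rewrite mxE scale0r.
by under eq_bigr do rewrite mxE.
Qed.

End Basis.

(** The monomials of the chart are sorted by class. Those of class i descend to a basis modulo
    [I i], so their number is the colength [n i]. *)
Lemma exists_split_chart (n : 'I_k -> nat) N (B : 'I_N -> mon)
    (J : hilb_pt F N) (I : forall i, hilb_pt F (n i)) :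
    splits (sval J) (fun i => sval (I i)) -> hilb_chart B J ->
  exists (s : forall i, 'I_(n i) -> 'I_N) (C : forall i, 'I_(n i) -> mon),
    bijective (fun u : {i : 'I_k & 'I_(n i)} => s _ (tagged u)) /\
    forall i j, B (s i j) = mon_up k i (C i j).
Proof.
move=> JI cJ.
pose T i := [pred t : 'I_N | mon_class k_gt0 (B t) == i].
pose s i (j : 'I_(#|T i|)) : 'I_N := enum_val j.
pose C i (j : 'I_(#|T i|)) : mon := mon_low k (B (s i j)).
have sP i j : mon_class k_gt0 (B (s i j)) = i by exact/eqP/(enum_valP j).
have BC i j : B (s i j) = mon_up k i (C i j).
  by rewrite /C -[in mon_up k i](sP i j) mon_lowK.
have s_bij : bijective (fun u : {i : 'I_k & 'I_(#|T i|)} => s _ (tagged u)).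
  apply: inj_card_bij => [[i j] [i' j']|].
    move=> /= E; have ii' : i = i' by rewrite -(sP i j) E sP.
    by case: _ / ii' j' E => j' /enum_val_inj ->.
  rewrite tagnat.card -sum1_card.
  rewrite (partition_big (fun t => mon_class k_gt0 (B t)) xpredT) //=.
  by apply: leq_sum => i _; rewrite -sum1_card.
(* The blocks built so far have size [#|T i|]; this equality allows them to be indexed by [n i]. *)
suff Tn i : #|T i| = n i.
  have {Tn} -> : n = fun i => #|T i| by apply/funext => i; rewrite Tn.
  by exists s, C.
apply: (quot_dim_unique (ideal_subspace (sval (I i)))) (proj2_sig (I i)).
exists (fun j => 'X_[C i j]).
apply: (direct_sum_basis_component (V' := fun=> setT)
  (W' := fun i => ideal_set (sval (I i))) (e := fun t => 'X_[B t])
  (e' := fun i j => 'X_[C i j]) s_bij JI _ _ (q := fun i : 'I_k => emb i)) => //.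
- by move=> i' j; rewrite /= BC -embX part_emb eqxx.
- by move=> i' i'' j i'i; rewrite /= BC -embX part_emb (negPf i'i).
- by move=> i' g _; rewrite /= part_emb eqxx.
Qed.

Lemma splits_qhom_ideal J I :
  splits J I -> (qhom_ideal 1 k J <-> forall i, qhom_ideal 1 1 (I i)).
Proof.
move=> JI; split=> [qJ i g Ig j | qI f Jf d].
  rewrite -(splits_emb i _ JI) (emb_qhom_part k_gt0).
  by apply: qJ; rewrite (splits_emb i _ JI).
have [e [j ->]] := modk_eq k_gt0 d; apply/JI => i.
rewrite part_qhom_part; case: eqP => _; last exact: ideal_zero.
by apply: qI; move: i; exact/JI.
Qed.

(** [part i] and [emb i] are inverse isomorphisms between the forms of degree i + k j and those of
    degree j, and they match [J] with [I i]. *)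
Lemma splits_quot_dim J I (i : 'I_k) j h :
    splits J I ->
  quot_dim (qhom 1 k (i + k * j)) (J `&` qhom 1 k (i + k * j)) h <->
  quot_dim (qhom 1 1 j) (I i `&` qhom 1 1 j) h.
Proof.
move=> JI; have JIg := splits_emb i _ JI; split.
  apply: (quot_dim_transfer (f := part i) (g := emb i)).
  - exact: qhom_subspace.
  - exact: part_qhom.
  - exact: (emb_qhom k_gt0).
  - by move=> g _; rewrite /= part_emb eqxx.
  - move=> f qf; have fE := emb_part_qhom k_gt0 qf.
    split=> [[Jf _]|[If _]]; split=> //; last by rewrite -fE JIg.
      by move: Jf; rewrite -{1}fE JIg.
    exact: part_qhom.
apply: (quot_dim_transfer (f := emb i) (g := part i)).
- exact: qhom_subspace.
- exact: (emb_qhom k_gt0).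
- exact: part_qhom.
- by move=> f qf; rewrite /= (emb_part_qhom k_gt0 qf).
- move=> g qg; split=> [[Ig _]|[Jg _]]; split=> //.
  + by rewrite JIg.
  + exact: (emb_qhom k_gt0).
  + by rewrite -JIg.
Qed.



Lemma qhom_part_emb_part (i e : 'I_k) j f :
  qhom_part 1 k (e + k * j) (emb i (part i f)) =
  if e == i then qhom_part 1 k (e + k * j) f else 0.
Proof.
apply: (part_inj (k_gt0 := k_gt0)) => c; rewrite part_qhom_part part_emb.
have [->|ei] := eqVneq e i.
  by rewrite part_qhom_part; case: eqVneq => [->|].
rewrite linear0; case: eqVneq => // <-.
by rewrite eq_sym (negPf ei) linear0.
Qed.

(** * From a homogeneous ideal to its components *)

Section Slice.
Variables (J : ideal F) (i : 'I_k).

Let slice_set : set poly2 := [set g | ideal_set J (emb i g)].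

Fact slice_zero : slice_set 0.
Proof. by rewrite /slice_set /= linear0; exact: ideal_zero. Qed.

Fact slice_add f g : slice_set f -> slice_set g -> slice_set (f + g).
Proof. by move=> Jf Jg; rewrite /slice_set /= linearD; exact: ideal_add. Qed.

Fact slice_mul f g : slice_set g -> slice_set (f * g).
Proof.
by move=> Jg; rewrite /slice_set /= -[nat_of_ord i]add0n embM; exact: ideal_mul.
Qed.

Definition slice : ideal F := Ideal slice_zero slice_add slice_mul.

End Slice.

(** The class i component of [f] collects the homogeneous parts of [f] in the degrees congruent to i
    modulo k, and these lie in [J] when [f] does. *)
Lemma splits_slice J : qhom_ideal 1 k J -> splits J (slice J).
Proof.
move=> qJ f; split=> [Jf i | Jf]; last first.
  rewrite (sum_emb_part k_gt0 f).
  by apply: (subspace_sum (ideal_subspace J)) => i _; exact: Jf.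
apply/(ideal_qhom_parts _ qJ) => d; have [e [j ->]] := modk_eq k_gt0 d.
rewrite qhom_part_emb_part; case: eqP => _; last exact: ideal_zero.
exact: qJ.
Qed.

Lemma slice_le J (i j : 'I_k) : (i <= j)%N -> slice J i `<=` slice J j.
Proof.
(* Passing from class i to class j is multiplication by x^(j - i). *)
move=> ij g Jg; rewrite /slice /= -[nat_of_ord j](subnK ij) -[g]mul1r embM.
exact: ideal_mul.
Qed.

(** * From components to an ideal *)

Section Glue.
Variable I : 'I_k -> ideal F.
Hypothesis I_le : forall i j : 'I_k, (i <= j)%N -> I i `<=` I j.
Hypothesis I_mulx : forall i j g, ideal_set (I i) g -> ideal_set (I j) (x * g).

Let glue_set : set poly2 := [set f | forall i, ideal_set (I i) (part i f)].

Fact glue_zero : glue_set 0.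
Proof. by move=> i; rewrite linear0; exact: ideal_zero. Qed.

Fact glue_add f g : glue_set f -> glue_set g -> glue_set (f + g).
Proof. by move=> Jf Jg i; rewrite linearD; exact: ideal_add. Qed.

(** A product of terms of classes l and j has class l + j, which is at least j, and [I_le] applies;
    or it overflows to l + j - k with a carry u, and [I_mulx] applies. *)
Fact glue_mul f g : glue_set g -> glue_set (f * g).
Proof.
move=> Jg i; rewrite (sum_emb_part k_gt0 f) mulr_suml linear_sum.
apply: (subspace_sum (ideal_subspace (I i))) => l _.
rewrite [X in _ * X](sum_emb_part k_gt0 g) mulr_sumr linear_sum.
apply: (subspace_sum (ideal_subspace (I i))) => j _; rewrite -embM /=.
have [ljk | klj] := ltnP (l + j) k.
  rewrite (part_emb k_gt0 i (Ordinal ljk)).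
  case: eqP => [<-|_]; last exact: ideal_zero.
  by apply: ideal_mul; apply: I_le (Jg j); rewrite leq_addl.
have ljk : (l + j - k < k)%N.
  by rewrite ltn_subLR // -addSn leq_add // ltnW.
rewrite -(subnK klj) emb_addk (part_emb k_gt0 i (Ordinal ljk)).
case: eqP => [_|_]; last exact: ideal_zero.
by rewrite mulrCA; apply: ideal_mul; exact: I_mulx (Jg j).
Qed.

Definition glue : ideal F := Ideal glue_zero glue_add glue_mul.

Lemma splits_glue : splits glue I.
Proof. by []. Qed.

End Glue.

End Splitting.

(** * The isomorphism *)

Lemma sig_ext (T : Type) (P : T -> Prop) (u v : {x | P x}) :
  sval u = sval v -> u = v.
Proof. by case: u v => [u p] [v q] /=; exact: eq_exist. Qed.

Section Isomorphism.
Variables (F : fieldType) (k : nat) (k_gt0 : (0 < k)%N).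
Variables (n : 'I_k -> nat) (d : 'I_k -> nat -> nat) (H : nat -> nat).
Hypothesis sum_d : forall i, sums_to (d i) (n i).
Hypothesis H_d : forall (i : 'I_k) j, H (i + k * j) = d i j.
Hypothesis consecutive : forall j,
  (forall l l', d l j = d l' j) \/ (forall l l', d l j.+1 = d l' j.+1).

Local Notation N := (\sum_(i < k) n i)%N.
Local Notation nested := (nested_qhilb F 1 1 n d).
Local Notation qhilb := (qhilb F 1 k N H).
Local Notation splits := (splits (F := F) k_gt0).
Local Notation mon := 'X_{1..2}.

(** Only j < i needs an argument. There [I j] is contained in [I i], and in a degree of E both have
    the same codimension, so they coincide. For a part of degree e, either e is in E and the part
    itself is in [I j], or e + 1 is in E and its product with x is. *)
Lemma nested_mulx (I : 'I_k -> ideal F) :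
    (forall i j : 'I_k, (i <= j)%N -> I i `<=` I j) ->
    (forall i, qhom_ideal 1 1 (I i)) ->
    (forall i j, quot_dim (qhom 1 1 j) (I i `&` qhom 1 1 j) (d i j)) ->
  forall i j g, ideal_set (I i) g -> ideal_set (I j) (varx F * g).
Proof.
move=> I_le qI dimI i j g Ig; have [ij|/ltnW ji] := leqP i j.
  by apply: ideal_mul; exact: I_le Ig.
have same e f : (forall l l', d l e = d l' e) -> qhom 1 1 e f ->
    ideal_set (I i) f -> ideal_set (I j) f.
  move=> de qf If; have dimi := dimI i e; rewrite (de i j) in dimi.
  have sub : I j `&` qhom 1 1 e `<=` I i `&` qhom 1 1 e.
    by move=> f' [Ijf' qf']; split=> //; exact: I_le Ijf'.
  by have [] := quot_dim_subset (ideal_qhom_subspace 1 1 e (I j))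
    (ideal_qhom_subspace 1 1 e (I i)) sub (dimI j e) dimi (conj qf (conj If qf)).
have [M /(_ M (leqnn M)) ->] := sum_qhom_part 1 1 g.
rewrite mulr_sumr; apply: (subspace_sum (ideal_subspace (I j))) => e _.
have qe := @qhom_part_qhom _ 1 1 e g; have Ie := qI i _ Ig e.
have [de|de] := consecutive e.
  by apply: ideal_mul; exact: same de qe Ie.
by apply: same de _ _; [exact: qhom_mulx | exact: ideal_mul].
Qed.

Lemma exists_glue (I : nested) :
  exists J : qhilb, splits (sval (sval J)) (fun i => sval (sval I i)).
Proof.
case: I => I [I_nested I_qhilb] /=; set I' := fun i => sval (I i).
have qI i : qhom_ideal 1 1 (I' i) by case: (I_qhilb i).
have dI i j : quot_dim (qhom 1 1 j) (I' i `&` qhom 1 1 j) (d i j).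
  by case: (I_qhilb i).
have I_le (i j : 'I_k) : (i <= j)%N -> I' i `<=` I' j.
  by rewrite leq_eqVlt => /predU1P[/val_inj ->|/I_nested].
pose J := glue k_gt0 I_le (nested_mulx I_le qI dI).
have JI : splits J I' := splits_glue _ _ _.
have dimJ : quot_dim setT J N.
  apply: (direct_sum_quot_dim (V' := fun=> setT) (q := fun i : 'I_k => emb k i)
    (W' := fun i => ideal_set (I' i)) JI) => //.
  - by move=> i g _; rewrite /= part_emb eqxx.
  - by move=> i i' g _ i'i; rewrite /= part_emb (negPf i'i).
  - by move=> i; exact: proj2_sig (I i).
have qJ : qhom_ideal 1 k J by apply/(splits_qhom_ideal JI).
have J_qhilb : @qhilb_set F 1 k N H (exist _ J dimJ).
  split=> //; first exact: qhom_ideal_torus_fixed.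
  move=> e; have [i [j ->]] := modk_eq k_gt0 e.
  by rewrite H_d; apply/(splits_quot_dim i j _ JI); exact: dI.
by exists (exist _ (exist _ J dimJ) J_qhilb).
Qed.

Lemma exists_slice (J : qhilb) :
  exists I : nested, splits (sval (sval J)) (fun i => sval (sval I i)).
Proof.
case: J => -[J dimJ] [/= _ qJ dJ].
have JI := splits_slice k_gt0 qJ; have qI := (splits_qhom_ideal JI).1 qJ.
have dI i j : quot_dim (qhom 1 1 j) (slice J i `&` qhom 1 1 j) (d i j).
  by apply/(splits_quot_dim i j _ JI); rewrite -H_d; exact: dJ.
pose I i : hilb_pt F (n i) :=
  exist _ (slice J i) (qhom_ideal_quot_dim (qI i) (sum_d i) (dI i)).
have I_nested : (@nested_set F k n `&` [set I : forall i, hilb_pt F (n i) |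
    forall i, @qhilb_set F 1 1 (n i) (d i) (I i)]) I.
  split=> [i j ij | i]; first exact: slice_le (ltnW ij).
  by split; [exact: qhom_ideal_torus_fixed (qI i) | exact: qI | exact: dI].
by exists (exist _ I I_nested).
Qed.

Theorem nested_qhilb_isomorphic : isomorphic nested qhilb.
Proof.
(* Both maps are chosen from the relation [splits], in which each side determines the other; hence
   they are mutually inverse. *)
have [phi phiP] := choice exists_glue; have [psi psiP] := choice exists_slice.
exists phi, psi; split.
- apply: morphism_of_charts => I B /= cB.
  have [s [C [s_bij BC]]] := exists_split_chart (phiP I) cB.
  exists C; split.
  + exact/(splits_chart s_bij BC (phiP I)).
  + by move=> I' /(splits_chart s_bij BC (phiP I')).
  case=> m t; have [s' _ s'K] := s_bij; rewrite -[t]s'K.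
  (* The coordinate pulls back to one of block i if [m] has class i, and to zero otherwise. *)
  case: (s' t) => i j /=; have [mi|mi] := eqVneq (mon_class k_gt0 m) i.
    exists (@Defs.coord F nested C (Tagged _ (mon_low k m, j))).
    split=> [|I' /(splits_chart s_bij BC (phiP I')) cI'].
      exact: polynomial_on_coord.
    by rewrite (splits_coord s_bij BC m j (phiP I') cI') mi eqxx.
  exists (fun=> 0); split=> [|I' /(splits_chart s_bij BC (phiP I')) cI'].
    exact: polynomial_on_const.
  by rewrite (splits_coord s_bij BC m j (phiP I') cI') (negPf mi).
- apply: morphism_of_charts => J C /= cC.
  pose T i := 'I_(n i).
  pose s i (j : 'I_(n i)) := tagnat.rank (Tagged T j).
  (* The charts of the components are lifted to monomials of their class and concatenated. *)
  pose B t := let u := tagnat.sig t in mon_up k (tag u) (C (tag u) (tagged u)).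
  have BC i (j : 'I_(n i)) : B (s i j) = mon_up k i (C i j).
    by rewrite /B /s tagnat.rankK.
  have s_bij := rank_tagged_bij n.
  exists B; split.
  + exact/(splits_chart s_bij BC (psiP J)).
  + by move=> J' /(splits_chart s_bij BC (psiP J')).
  case=> i [m j]; exists (@Defs.coord F qhilb B (mon_up k i m, s i j)).
  split=> [|J' cJ']; first exact: polynomial_on_coord.
  rewrite /= (splits_coord s_bij BC (mon_up k i m) j (psiP J') cJ').
  by rewrite mon_class_up eqxx mon_upK.
- move=> I; apply: sig_ext; apply: functional_extensionality_dep => i.
  by apply: sig_ext; exact: splits_injr i (psiP (phi I)) (phiP I).
move=> J; apply: sig_ext; apply: sig_ext.
exact: splits_injl (phiP (psi J)) (psiP J).
Qed.

End Isomorphism.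

Theorem theorem1p7 (R : realType) (k : nat) (hk : (1 <= k)%N)
    (n : 'I_k -> nat)
    (hn : forall i j : 'I_k, (i <= j)%N -> (n j <= n i)%N)
    (d : 'I_k -> nat -> nat)
    (hd : forall i : 'I_k, sums_to (d i) (n i))
    (E : nat -> Prop)
    (hE : forall j : nat, E j <-> (forall l l' : 'I_k, d l j = d l' j))
    (H : nat -> nat)
    (hH : forall (i : 'I_k) (j : nat), H (i + k * j)%N = d i j)
    (hsep : forall i j : nat, ~ E i -> ~ E j -> (i < j)%N -> (2 <= j - i)%N) :
  isomorphic (nested_qhilb (complex R) 1 1 n d)
             (qhilb (complex R) 1 k (\sum_(i < k) n i)%N H).
Proof.
apply: (nested_qhilb_isomorphic (complex R) hk hd hH) => j.
rewrite -!hE; have [Ej|nEj] := EM (E j); first by left.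
(* Otherwise j and j + 1 both lie outside E, at distance 1. *)
right; apply: contrapT => nEj1.
by have := hsep _ _ nEj nEj1 (ltnSn j); rewrite subSnn.
Qed.
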